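(* Let $G=G_1\oplus G_2$ be a finitely generated abelian group with $G_1\cong\mathbb{Z}^m$ and $G_2\cong\bigoplus_{i=1}^l\mathbb{Z}_{q_i}$, let $S$ be a finite symmetric generating set of $G$, and let $d\ge 0$ be real. Then $$HM^d(G,S)=H^d(G,S)=H^d(G_1,\pi_{G_1}S),$$ where a function $g$ on $G_1$ is identified with the function $g\circ\pi_{G_1}$ on $G$.
   Context: Group: $m\ge 1$ and $l\ge 0$ are integers ($l=0$ being the torsion-free case), and each $q_i=p_i^{a_i}$ is a prime power. $\pi_{G_1}:G\to G_1$ is the projection $x_1+x_2\mapsto x_1$ ($x_1\in G_1$, $x_2\in G_2$). Generating sets: a finite symmetric generating set is a finite list $S=(s_1,\dots,s_{2r})$ of elements generating $G$ with $s_{i+r}=-s_i$ for $1\le i\le r$; repetitions are allowed and $0\in S$ is allowed. $\pi_{G_1}S=(\pi_{G_1}s_1,\dots,\pi_{G_1}s_{2r})$, taken as a list (keeping repetitions and zeros), is a finite symmetric generating set of $G_1$. The Cayley graph $(G,S)$ has vertex set $G$ and $x\sim y$ iff $y-x\in S$; sums over $y\sim x$ are taken with multiplicity, i.e. $\sum_{y\sim x}h(y)=\sum_{i=1}^{2r}h(x+s_i)$. $d^S$ is the word metric (length of a shortest path in the Cayley graph). Laplacian: $L^Su(x)=\sum_{y\sim x}(u(y)-u(x))$. Function spaces: for a fixed base point $p\in G$, $$H^d(G,S)=\{u:G\to\mathbb{R}\mid L^Su=0 \text{ on } G,\ \exists C:\ |u(x)|\le C(d^S(p,x)+1)^d\ \forall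 x\in G\},$$ $$HM^d(G,S)=\mathrm{Span}\{u:G\to\mathbb{R}\mid L^Su=0 \text{ on } G,\ \exists C:\ u(x)\ge -C(d^S(p,x)+1)^d\ \forall x\in G\}$$ (real linear span); $H^d(G_1,\pi_{G_1}S)$ is defined in the same way as $H^d(G,S)$, for the group $G_1$ with generating set $\pi_{G_1}S$. *)

(* Defs.v *)
From HB Require Import structures.
From mathcomp Require Import all_boot all_order all_algebra.
From mathcomp Require Import all_classical all_reals all_analysis.

Set Implicit Arguments.
Unset Strict Implicit.
Unset Printing Implicit Defensive.

Import Order.TTheory GRing.Theory Num.Theory.
Local Open Scope classical_set_scope.
Local Open Scope ring_scope.

Definition isom_Zm (m : nat) (G : zmodType) : Prop :=
  exists f : {additive G -> 'rV[int]_m}, bijective f.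

(* MathComp has no group structure on dependent finite functions, so additivity
   of the isomorphism is spelled out coordinatewise.  'Z_n is Z/nZ only for
   n > 1, which holds wherever this is used with prime powers. *)
Definition isom_sum_Zq (l : nat) (q : 'I_l -> nat) (G : zmodType) : Prop :=
  exists f : G -> {dffun forall i : 'I_l, 'Z_(q i)},
    (forall x y i, f (x + y) i = f x i + f y i) /\ bijective f.

(* A generating list is a tuple, so repetitions and 0 are allowed; its second
   half lists the opposites of its first half, in order. *)
Definition symmetric_generating (G : zmodType) (r : nat) (S : (r + r).-tuple G)
  : Prop :=
  (forall i : 'I_r, tnth S (rshift r i) = - tnth S (lshift r i)) /\
  (forall H : {pred G}, zmod_closed H -> {subset S <= H} -> forall x, x \in H).

Section Cayley.
Variables (G : zmodType) (n : nat) (S : n.-tuple G).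

Definition cayley : rel G := fun x y => y - x \in S.

Definition joins (x y : G) (w : seq G) : Prop :=
  path cayley x w /\ last x w = y.

(* Length of a shortest path; 0 by convention if x and y are not connected,
   which cannot happen when S generates G. *)
Definition word_dist (x y : G) : nat :=
  xget 0%N [set k | (exists2 w, joins x y w & size w = k) /\
                    (forall w, joins x y w -> (k <= size w)%N)].

Variable R : realType.

Definition laplacian (u : G -> R) (x : G) : R :=
  \sum_(s <- S) (u (x + s) - u x).

Definition harmonic_on (u : G -> R) : Prop := forall x, laplacian u x = 0.

Definition growth (p : G) (d : R) (x : G) : R :=
  ((word_dist p x)%:R + 1) `^ d.

Definition Hd (p : G) (d : R) : set (G -> R) :=
  [set u | harmonic_on u /\ exists C : R, forall x, `|u x| <= C * growth p d x].

Definition lower_bounded_harmonic (p : G) (d : R) : set (G -> R) :=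
  [set u | harmonic_on u /\ exists C : R, forall x, - C * growth p d x <= u x].

Definition linear_span (A : set (G -> R)) : set (G -> R) :=
  [set u | exists (k : nat) (c : 'I_k -> R) (v : 'I_k -> G -> R),
     (forall i, A (v i)) /\ forall x, u x = \sum_(i < k) c i * v i x].

Definition HMd (p : G) (d : R) : set (G -> R) :=
  linear_span (lower_bounded_harmonic p d).

End Cayley.

(* Main.v *)
Require Import Defs.
From HB Require Import structures.
From mathcomp Require Import all_boot all_order all_algebra.
From mathcomp Require Import all_classical all_reals all_analysis.
From mathcomp Require Import ring lra zify.

(**
Writing [x = sum_i z_i s_i] lifts a function on [G] to one on the lattice [Z^r],
harmonic for the simple random walk [X_n] and with growth measured by the
l1-norm; changing the base point or projecting to [G1] does not affect such
growth bounds up to constants.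

Let [U] be harmonic on [Z^r] with [U >= - C (1 + |z|)^d].  As
[E U(X_n) = U(0)], the mean of [|U(X_n)|] is at most polynomial in [n], and
[P(X_n = z)] is at least a negative power of [n] when [n] is about [|z|^2]
(the multinomial distribution is near its mode); so [U] has polynomial growth.
By orthogonality of martingale increments,
[E U(X_n)^2 = sum_j binom(n, j) (2 r)^(-j) sum |iterated differences of order j at 0|^2],
so that high order differences vanish and [U] is a polynomial.  If its degree [D]
exceeded [d], then [E U(X_n)^2 >= c n^D] and [E U(X_n)^4 <= C n^(2 D)] would force
[E |U(X_n)| >= c n^(D/2)], whereas the lower bound gives
[E |U(X_n)| <= U(0) + 2 C E (1 + |X_n|)^d = O(n^(d/2))].  Hence [D <= d].
Finally, a polynomial that is periodic in a torsion direction is constant in that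
direction, which gives the invariance under [G2].
*)

Set Implicit Arguments.
Unset Strict Implicit.
Unset Printing Implicit Defensive.

Import Order.TTheory GRing.Theory Num.Theory.
Local Open Scope classical_set_scope.
Local Open Scope ring_scope.

(** * Averaging operators and differences *)

Section Walk.
Variables (R : realType) (A : zmodType) (S : seq A).
Implicit Types (f g u : A -> R) (x s : A) (l : seq A).

(** Transition operator of the random walk: [iter n avg f x] is the mean of [f] at x + X_n, and
    [avg u = u] is harmonicity. *)
Definition avg f x : R := (size S)%:R^-1 * \sum_(s <- S) f (x + s).

Definition fdiff s f x : R := f (x + s) - f x.

Fixpoint fdiffs l f : A -> R := if l is s :: l' then fdiffs l' (fdiff s f) else f.

(** With [S] the generators of the lattice: [f] is a polynomial of degree less than [k]. In
    particular [deg_lt 0 f] means [f = 0]. *)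
Definition deg_lt k f := forall l, all (mem S) l -> size l = k ->
  forall x, fdiffs l f x = 0.

Lemma avg_iter_mono n f g x : (forall y, f y <= g y) ->
  iter n avg f x <= iter n avg g x.
Proof.
move=> fg; elim: n x => [|n IHn] x //=.
by rewrite ler_wpM2l ?invr_ge0 // ler_sum.
Qed.

Lemma avg_iter_ge0 n f x : (forall y, 0 <= f y) -> 0 <= iter n avg f x.
Proof.
move=> f0; elim: n x => [|n IHn] x //=.
by rewrite mulr_ge0 ?invr_ge0 // sumr_ge0.
Qed.

Lemma avg_iter_lin n a b f g x :
  iter n avg (fun y => a * f y + b * g y) x =
  a * iter n avg f x + b * iter n avg g x.
Proof.
elim: n x => [|n IHn] x //=; rewrite {1}/avg.
under eq_bigr do rewrite IHn.
rewrite big_split /= -!mulr_sumr /avg; ring.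
Qed.

Lemma avg_iterZ n a f x :
  iter n avg (fun y => a * f y) x = a * iter n avg f x.
Proof.
have := avg_iter_lin n a 0 f f x; rewrite mul0r addr0 => <-.
by congr (iter n avg _ x); apply/funext => y; rewrite mul0r addr0.
Qed.

Lemma avg_iter_sum n f x : (0 < size S)%N ->
  iter n (fun h y => \sum_(s <- S) h (y + s)) f x =
  (size S)%:R ^+ n * iter n avg f x.
Proof.
move=> S0; elim: n x => [|n IHn] x /=; first by rewrite mul1r.
under eq_bigr do rewrite IHn.
rewrite -mulr_sumr /avg exprS; set q := _%:R; have q0 : q != 0 :> R.
  by rewrite pnatr_eq0 -lt0n.
by field.
Qed.

Lemma avg_iter_fix n u : avg u = u -> iter n avg u = u.
Proof. by move=> hu; elim: n => //= n ->. Qed.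

Lemma avg_fdiff s u : avg u = u -> avg (fdiff s u) = fdiff s u.
Proof.
move=> hu; apply/funext => x; rewrite /avg /fdiff.
under eq_bigr do rewrite addrAC.
by rewrite sumrB mulrBr -/(avg u (x + s)) -/(avg u x) hu.
Qed.

(** Increments are orthogonal: the cross term vanishes because the differences of [u] at [x] have
    mean zero over [S]. *)
Lemma avg_sqr u x : (0 < size S)%N -> avg u = u ->
  avg (fun y => u y ^+ 2) x =
  u x ^+ 2 + (size S)%:R^-1 * \sum_(s <- S) fdiff s u x ^+ 2.
Proof.
move=> S0 hu; have q0 : (size S)%:R != 0 :> R by rewrite pnatr_eq0 -lt0n.
have hs : \sum_(s <- S) u (x + s) = (size S)%:R * u x.
  by rewrite -{2}hu /avg mulrA divff // mul1r.
have -> : \sum_(s <- S) fdiff s u x ^+ 2 =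
  \sum_(s <- S) u (x + s) ^+ 2 - (size S)%:R * u x ^+ 2.
  under eq_bigr => s _.
    rewrite /fdiff (_ : _ ^+ 2 = u (x + s) ^+ 2 - ((u x *+ 2) * u (x + s) - u x ^+ 2)).
    over.
    by ring.
  rewrite !sumrB -mulr_sumr hs big_const_seq count_predT iter_addr_0; ring.
by rewrite /avg; field.
Qed.

(* The exact expansion is
   [E_n (u^2) = sum_j binom(n,j) q^-j sum_(s_1..s_j) (fdiffs [s_1..s_j] u)^2]. *)
Lemma fdiffs_sqr_le n l u x : (0 < size S)%N -> avg u = u -> all (mem S) l ->
  'C(n, size l)%:R * (size S)%:R ^- size l * fdiffs l u x ^+ 2 <=
  iter n avg (fun y => u y ^+ 2) x.
Proof.
move=> S0.
have step v m y : avg v = v -> iter m.+1 avg (fun y => v y ^+ 2) y =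
    iter m avg (fun y => v y ^+ 2) y +
    (size S)%:R^-1 * \sum_(s <- S) iter m avg (fun y => fdiff s v y ^+ 2) y.
  move=> hv; elim: m y => [|m IHm] y; first exact: avg_sqr.
  rewrite iterS {1}/avg; under eq_bigr do rewrite IHm.
  rewrite big_split mulrDr /= -/(avg _ y); congr (_ + _ * _).
  rewrite -mulr_sumr exchange_big mulr_sumr; apply: eq_bigr => s _ //.
elim: l u n => [|s l IHl] u n hu.
  move=> _; rewrite bin0 expr0 invr1 !mul1r /=.
  elim: n x => [|n IHn] x //; rewrite step //.
  apply: le_trans (IHn x) _; rewrite lerDl mulr_ge0 ?invr_ge0 // sumr_ge0 // => s _.
  by apply: avg_iter_ge0 => y; rewrite sqr_ge0.
move=> /andP[sS lS]; elim: n => [|n IHn].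
  by rewrite bin0n !mul0r sqr_ge0.
(* Pascal's rule: one summand is [IHn], the other is the bound for the harmonic function [fdiff s u]
   and the list [l]. *)
rewrite step // binS natrD !mulrDl lerD //.
have hI := IHl (fdiff s u) n (avg_fdiff s hu) lS.
apply: (@le_trans _ _ ((size S)%:R^-1 * iter n avg (fun y => fdiff s u y ^+ 2) x)).
  apply: le_trans (ler_wpM2l _ hI); rewrite ?invr_ge0 //= le_eqVlt.
  by rewrite exprSr invfM !mulrA [_ / _ in X in X * _]mulrAC (mulrC _^-1) eqxx.
rewrite ler_wpM2l ?invr_ge0 // (perm_big _ (perm_to_rem sS)) big_cons /=.
by rewrite lerDl sumr_ge0 // => s' _; apply: avg_iter_ge0 => y; rewrite sqr_ge0.
Qed.

End Walk.

(** * Lower bounds on the walk kernel *)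

Lemma fact_le_expn M j i : (j + i <= M)%N -> ((j + i)`! <= j`! * M ^ i)%N.
Proof.
elim: i => [|i IHi] h; first by rewrite addn0 muln1.
rewrite addnS factS expnS mulnCA leq_mul ?IHi //; lia.
Qed.

(** The sequence k^j / j! does not decrease before j = k and does not increase after it. *)
Lemma fact_expn_min k j : (k`! * k ^ j <= j`! * k ^ k)%N.
Proof.
have [kj|/ltnW jk] := leqP k j.
  rewrite -(subnKC kj); elim: (j - k)%N => [|i IHi]; first by rewrite addn0.
  rewrite addnS expnS factS mulnCA -mulnA leq_mul //; lia.
have [i kE] : exists i, k = (j + i)%N by exists (k - j)%N; rewrite subnKC.
have -> : (k ^ k = k ^ j * k ^ i)%N by rewrite -expnD -kE.
by rewrite mulnC mulnCA leq_mul2l [X in (X`! <= _)%N]kE fact_le_expn ?orbT // kE.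
Qed.

(* The largest term in the binomial expansion of [(k + m) ^ (k + m)] is the one
   of index [k]. *)
Lemma binomial_mode k m :
  ((k + m) ^ (k + m) <= (k + m).+1 * ('C(k + m, k) * (k ^ k * m ^ m)))%N.
Proof.
rewrite {1}addnC [X in (X <= _)%N]expnDn.
apply: (@leq_trans (\sum_(i < (k + m).+1) 'C(k + m, k) * (k ^ k * m ^ m))%N);
  last by rewrite sum_nat_const card_ord.
apply: leq_sum => i _; have ile : (i <= k + m)%N by rewrite -ltnS.
have i_pos : (0 < i`! * (k + m - i)`! * (k`! * m`!))%N by rewrite !muln_gt0 !fact_gt0.
(* With the factorials cleared, the comparison is a product of two instances of [fact_expn_min]. *)
rewrite -(leq_pmul2r i_pos).
have hi := bin_fact ile; have hk := bin_fact (leq_addr m k).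
rewrite addKn in hk.
have h1 := fact_expn_min k i; have h2 := fact_expn_min m (k + m - i).
have -> : ('C(k + m, i) * (m ^ (k + m - i) * k ^ i) * (i`! * (k + m - i)`! * (k`! * m`!))
  = (k + m)`! * ((k`! * k ^ i) * (m`! * m ^ (k + m - i))))%N.
  by rewrite -{1}hi; ring.
have -> : ('C(k + m, k) * (k ^ k * m ^ m) * (i`! * (k + m - i)`! * (k`! * m`!))
  = (k + m)`! * ((i`! * k ^ k) * ((k + m - i)`! * m ^ m)))%N.
  by rewrite -{1}hk; ring.
by rewrite leq_mul2l leq_mul ?orbT.
Qed.

(** * A Harnack-type inequality *)

Section Harnack.
Variables (R : realType) (A : zmodType).
Implicit Types (v : A -> R) (x s : A).

(** [avg] without its normalisation, so that iterates can be bounded by counting words. *)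
Let shifts (S : seq A) v x : R := \sum_(s <- S) v (x + s).

Lemma shifts_cons s S v x : shifts (s :: S) v x = v (x + s) + shifts S v x.
Proof. by rewrite /shifts big_cons. Qed.

Lemma shifts_iter_ge0 S n v x : (forall y, 0 <= v y) -> 0 <= iter n (shifts S) v x.
Proof.
by move=> v0; elim: n x => //= n IHn x; apply: sumr_ge0 => s _.
Qed.

(** Keeps only the words of length [n] in which [s] fills [k] chosen positions and [S] the others;
    the rest is nonnegative. *)
Lemma shifts_iter_cons s S n k v x : (forall y, 0 <= v y) ->
  'C(n, k)%:R * iter (n - k) (shifts S) v (x + s *+ k) <=
  iter n (shifts (s :: S)) v x.
Proof.
move=> v0; elim: n k x => [|n IHn] [|k] x.
- by rewrite bin0 mul1r mulr0n addr0.
- by rewrite bin0n mul0r.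
- rewrite bin0 mul1r mulr0n addr0 subn0 !iterS shifts_cons.
  rewrite -[X in X <= _]add0r lerD ?shifts_iter_ge0 // ler_sum // => t _.
  by have := IHn 0%N (x + t); rewrite bin0 mul1r mulr0n addr0 subn0.
- rewrite [in X in _ <= X]iterS shifts_cons binS natrD mulrDl addrC lerD //.
    by rewrite subSS mulrS addrA IHn.
  have [kn|nk] := ltnP k n; last first.
    by rewrite bin_small // mul0r sumr_ge0 // => t _; apply: shifts_iter_ge0.
  rewrite subSS (_ : (n - k)%N = (n - k.+1).+1) /=; last by lia.
  by rewrite {1}/shifts mulr_sumr ler_sum // => t _; rewrite addrAC IHn.
Qed.

(** The endpoint is reached by all rearrangements of a word with these multiplicities. Their number
    is multinomial, and [binomial_mode], used once per letter, bounds it below by n^n / prod k^k up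
    to powers of n + 1. *)
Lemma shifts_iter_multinomial (l : seq (A * nat)) v x : (forall y, 0 <= v y) ->
  forall n, n = (\sum_(p <- l) p.2)%N -> (n ^ n)%:R * v (x + \sum_(p <- l) p.1 *+ p.2) <=
  (n.+1 ^ size l * \prod_(p <- l) p.2 ^ p.2)%:R * iter n (shifts (map fst l)) v x.
Proof.
move=> v0; elim: l x => [|[s k] l IHl] x n ->.
  by rewrite !big_nil /= !mul1r addr0.
rewrite /= !big_cons /=; set m := (\sum_(p <- l) p.2)%N; set c := (\prod_(p <- l) _)%N.
have := IHl (x + s *+ k) m erefl; rewrite /= -/c.
have := @shifts_iter_cons s (map fst l) (k + m) k v x v0; rewrite addKn.
rewrite -addrA; set V := v _; set I := iter m _ _ _; set J := iter _ _ _ _ => hJ hI.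
have V0 : 0 <= V by apply: v0.
have I0 : 0 <= I by apply: shifts_iter_ge0.
apply: (@le_trans _ _ (((k + m).+1 * ('C(k + m, k) * (k ^ k * m ^ m)))%:R * V)).
  by rewrite ler_wpM2r // ler_nat binomial_mode.
have -> : ((k + m).+1 * ('C(k + m, k) * (k ^ k * m ^ m)))%:R * V =
  ((k + m).+1 * k ^ k)%:R * 'C(k + m, k)%:R * ((m ^ m)%:R * V).
  by rewrite !natrM; ring.
apply: (le_trans (ler_wpM2l _ hI)); first by rewrite mulr_ge0.
have -> : (((k + m).+1 * k ^ k)%:R * 'C(k + m, k)%:R * ((m.+1 ^ size l * c)%:R * I)) =
  ((k + m).+1 * k ^ k * (m.+1 ^ size l * c))%:R * ('C(k + m, k)%:R * I) :> R.
  by rewrite !natrM; ring.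
apply: (le_trans (ler_wpM2l _ hJ)); first by [].
rewrite ler_wpM2r ?shifts_iter_ge0 // ler_nat expnS.
have -> : ((k + m).+1 * k ^ k * (m.+1 ^ size l * c) =
  (k + m).+1 * m.+1 ^ size l * (k ^ k * c))%N by ring.
rewrite leq_mul // leq_mul //.
by case: (size l) => // e; rewrite leq_exp2r // ltnS leq_addl.
Qed.

(** Nearly equal multiplicities have nearly maximal entropy: with q = [size c], the inequality t <=
    exp (t - 1) bounds the product of the (k q / n)^k by exp ((q sum k^2 - n^2) / n). *)
Lemma prod_expn_entropy (c : seq nat) n : (0 < n)%N ->
  (size c * \sum_(k <- c) k ^ 2 <= n ^ 2 + n)%N -> (\sum_(k <- c) k)%N = n ->
  (\prod_(k <- c) k ^ k)%:R * (size c)%:R ^+ n <= n%:R ^+ n * expR 1 :> R.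
Proof.
move=> n0 hc cn; have n0' : 0 < n%:R :> R by rewrite ltr0n.
set q : R := (size c)%:R.
have -> : (\prod_(k <- c) k ^ k)%:R * q ^+ n =
    n%:R ^+ n * \prod_(k <- c) (k%:R * q / n%:R) ^+ k.
  have pown (a : R) : a ^+ n = \prod_(k <- c) a ^+ k by rewrite -{1}cn expr_sum.
  rewrite !pown natr_prod.
  rewrite -!big_split /=; apply: eq_bigr => k _; rewrite natrX -!exprMn.
  by rewrite mulrCA divff ?mulr1 // gt_eqF.
rewrite ler_wpM2l ?exprn_ge0 //.
apply: (@le_trans _ _ (\prod_(k <- c) expR (k%:R * (k%:R * q / n%:R - 1)))).
  apply: ler_prod => k _; rewrite exprn_ge0 ?divr_ge0 ?mulr_ge0 //=.
  rewrite expRM_natl lerXn2r ?nnegrE ?expR_ge0 ?divr_ge0 ?mulr_ge0 //.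
  by apply: le_trans (expR_ge1Dx _); rewrite addrC subrK.
rewrite -(big_morph expR (@expRD R) (@expR0 R)) ler_expR.
have -> : \sum_(k <- c) k%:R * (k%:R * q / n%:R - 1) =
   (q * (\sum_(k <- c) k ^ 2)%:R - n%:R ^+ 2) / n%:R.
  rewrite (eq_bigr (fun k : nat => k%:R * (k%:R * q / n%:R) - k%:R)); last first.
    by move=> k _; rewrite mulrBr mulr1.
  rewrite sumrB -natr_sum cn natr_sum mulr_sumr mulrBl mulr_suml; congr (_ - _).
    by apply: eq_bigr => k _; rewrite natrX; ring.
  by rewrite expr2 mulfK // gt_eqF.
rewrite ler_pdivrMr // mul1r lerBlDl /q -natrX -natrM -natrD ler_nat //.
Qed.

(** The letters sum to 0, so (K + 1)^2 further copies of each do not move the endpoint, but they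
    make the multiplicities nearly equal. The walk then hits it with probability at least of order
    n^-q, q = [size l]. *)
Lemma le_avg_iter_nonneg (l : seq (A * nat)) v x : (forall y, 0 <= v y) ->
  (0 < size l)%N -> \sum_(p <- l) p.1 = 0 ->
  forall K n, K = (\sum_(p <- l) p.2)%N -> n = (size l * K.+1 ^ 2 + K)%N ->
  v (x + \sum_(p <- l) p.1 *+ p.2) <=
  expR 1 * n.+1%:R ^+ size l * iter n (avg (map fst l)) v x.
Proof.
move=> v0 l0 lz K n KE; set N := (K.+1 ^ 2)%N => nE'.
have hN : (K ^ 2 <= N)%N by rewrite leq_exp2r.
have N0 : (0 < N)%N by [].
clearbody N.
pose l' := [seq (p.1, N + p.2)%N | p <- l].
have n0 : (0 < n)%N by rewrite nE' addn_gt0 muln_gt0 l0 N0.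
have sl' : size l' = size l by rewrite size_map.
have fl' : map fst l' = map fst l by rewrite -map_comp.
have nE : (\sum_(p <- l') p.2)%N = n.
  by rewrite big_map big_split /= big_const_seq count_predT iter_addn_0 -KE nE' mulnC.
have zE : \sum_(p <- l') p.1 *+ p.2 = \sum_(p <- l) p.1 *+ p.2.
  rewrite big_map /=; under eq_bigr do rewrite mulrnDr.
  by rewrite big_split /= sumrMnl lz mul0rn add0r.
have := @shifts_iter_multinomial l' v x v0 n (esym nE); rewrite zE sl' fl'.
rewrite /shifts avg_iter_sum ?size_map // => h.
pose c := map snd l'.
have cn : (\sum_(k <- c) k)%N = n by rewrite big_map.
have sc : size c = size l by rewrite !size_map.
have sum_sqr (m : seq nat) : (\sum_(k <- m) k ^ 2 <= (\sum_(k <- m) k) ^ 2)%N.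
  elim: m => [|k m IHm]; first by rewrite !big_nil.
  by rewrite !big_cons; move: IHm; set a := bigop _ _ _; set b := bigop _ _ _; nia.
(* Up to q^2 N^2 + 2 q N K on both sides, with q = [size l], this follows from q Y <= q N <= n. *)
have hc : (size c * \sum_(k <- c) k ^ 2 <= n ^ 2 + n)%N.
  have := sum_sqr (map snd l); rewrite sc !big_map /= -KE.
  set Y := (\sum_(p <- l) p.2 ^ 2)%N => YK.
  have -> : (\sum_(p <- l) (N + p.2) ^ 2 = size l * N ^ 2 + 2 * N * K + Y)%N.
    under eq_bigr do rewrite sqrnD.
    rewrite !big_split /= big_const_seq count_predT iter_addn_0 -!big_distrr /= -KE -/Y.
    rewrite big1_eq; ring.
  have : (size l * Y <= size l * N)%N by rewrite leq_mul // (leq_trans YK).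
  rewrite nE'; set q := size l; nia.
have := @prod_expn_entropy c n n0 hc cn; rewrite sc => hP.
rewrite -(big_map snd predT (fun k => k ^ k)%N) -/c in h.
have nn : 0 < (n ^ n)%:R :> R by rewrite ltr0n expn_gt0 n0.
rewrite -(ler_pM2l nn); apply: (le_trans h).
set I := iter n _ _ _ in h *; set P := (\prod_(k <- c) k ^ k)%N in hP h *.
have I0 : 0 <= I by apply: avg_iter_ge0.
have -> : (n.+1 ^ size l * P)%:R * ((size l)%:R ^+ n * I) =
  n.+1%:R ^+ size l * I * (P%:R * (size l)%:R ^+ n).
  by rewrite natrM natrX; ring.
have -> : (n ^ n)%:R * (expR 1 * n.+1%:R ^+ size l * I) =
  n.+1%:R ^+ size l * I * (n%:R ^+ n * expR 1).
  by rewrite natrX; ring.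
by rewrite ler_wpM2l ?mulr_ge0 ?exprn_ge0.
Qed.
End Harnack.

(** * Harmonic functions on the lattice *)

(** Every factor of [n ^_ j] is at least n - j, hence at least n / 2. *)
Lemma expn_le_bin n j : (2 * j <= n)%N -> (n ^ j <= 2 ^ j * j`! * 'C(n, j))%N.
Proof.
move=> jn; rewrite -mulnA [(j`! * _)%N]mulnC bin_ffact.
apply: (@leq_trans (2 ^ j * (n - j) ^ j)).
  by rewrite -expnMn; case: (j) jn => // i jn; rewrite leq_exp2r //; lia.
rewrite leq_mul2l; apply/orP; right.
suff h i : (i <= j)%N -> ((n - j) ^ i <= n ^_ i)%N by apply: h.
by elim: i => // i IHi ij; rewrite expnSr ffactnSr leq_mul ?IHi //; lia.
Qed.

Section Lattice.
Variable r : nat.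
Implicit Types z w s : 'rV[int]_r.

Definition gens : seq 'rV[int]_r :=
  [seq delta_mx 0 i | i : 'I_r] ++ [seq - delta_mx 0 i | i : 'I_r].

Definition norm1 z : nat := (\sum_i `|z 0%R i|)%N.

Lemma size_gens : size gens = (r + r)%N.
Proof. by rewrite size_cat !size_image !card_ord. Qed.

Lemma big_gens (V : nmodType) (F : 'rV[int]_r -> V) :
  \sum_(s <- gens) F s = \sum_i F (delta_mx 0 i) + \sum_i F (- delta_mx 0 i).
Proof. by rewrite big_cat !big_image. Qed.

Lemma mem_gens i : (delta_mx 0 i \in gens) && (- delta_mx 0 i \in gens).
Proof.
by rewrite !mem_cat (codom_f (fun i => delta_mx 0 i)) //
  (codom_f (fun i => - delta_mx 0 i)) // orbT.
Qed.

Lemma norm10 : norm1 0 = 0%N.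
Proof. by rewrite /norm1 big1 // => i _; rewrite mxE. Qed.

Lemma norm1D z w : (norm1 (z + w) <= norm1 z + norm1 w)%N.
Proof. by rewrite /norm1 -big_split leq_sum // => i _; rewrite mxE /=; lia. Qed.

Lemma norm1N z : norm1 (- z) = norm1 z.
Proof. by apply: eq_bigr => i _; rewrite mxE abszN. Qed.

Lemma norm1_delta i : norm1 (delta_mx 0 i) = 1%N.
Proof.
rewrite /norm1 (bigD1 i) //= mxE !eqxx big1 // => j ji.
by rewrite mxE (negbTE ji) andbF.
Qed.

Lemma norm1_gens s : s \in gens -> norm1 s = 1%N.
Proof.
rewrite mem_cat => /orP[] /codomP[i ->]; last by rewrite norm1N norm1_delta.
exact: norm1_delta.
Qed.

Lemma norm1_pred z : z != 0 ->
  exists2 s, s \in gens & norm1 z = (norm1 (z - s)).+1.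
Proof.
move=> z0; have [i zi] : exists i, z 0 i != 0.
  apply/existsP; apply: contraR z0 => /existsPn h.
  by apply/eqP/rowP => i; rewrite mxE; have := h i; rewrite negbK => /eqP.
have [/andP[gp gm]] := mem_gens i.
have [zp|zn] := ltP 0 (z 0 i).
  exists (delta_mx 0 i) => //; rewrite /norm1 [LHS](bigD1 i) // [in RHS](bigD1 i) //=.
  rewrite -addSn; congr (_ + _)%N; first by rewrite !mxE !eqxx /=; lia.
  by apply: eq_bigr => j ji; rewrite !mxE (negbTE ji) andbF subr0.
exists (- delta_mx 0 i) => //; rewrite /norm1 [LHS](bigD1 i) // [in RHS](bigD1 i) //=.
rewrite -addSn; congr (_ + _)%N; first by rewrite !mxE !eqxx /=; lia.
by apply: eq_bigr => j ji; rewrite !mxE (negbTE ji) andbF opprK addr0.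
Qed.

Lemma lattice_ind (P : 'rV[int]_r -> Prop) : P 0 ->
  (forall z s, s \in gens -> norm1 (z + s) = (norm1 z).+1 -> P z -> P (z + s)) ->
  forall z, P z.
Proof.
move=> P0 PS z; have [n] := ubnP (norm1 z); elim: n z => // n IHn z zn.
have [->//|z0] := eqVneq z 0; have [s sg zs] := norm1_pred z0.
by rewrite -(subrK s z); apply: PS; rewrite ?subrK //; apply: IHn; rewrite zs in zn.
Qed.

Variable R : realType.
Implicit Types U : 'rV[int]_r -> R.

Notation walk := (@avg R _ gens).

Hypothesis r0 : (0 < r)%N.

Let q0 : (0 < size gens)%N. Proof. by rewrite size_gens addn_gt0 r0. Qed.

Lemma avg_iter_norm1 n (f : nat -> R) z :
  {homo f : m k / (m <= k)%N >-> m <= k} ->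
  iter n walk (fun y => f (norm1 y)) z <= f (norm1 z + n)%N.
Proof.
move=> fh; elim: n z => [|n IHn] z; first by rewrite addn0.
rewrite iterS /avg ler_pdivrMl ?ltr0n //.
apply: (@le_trans _ _ (\sum_(s <- gens) f (norm1 z + n.+1)%N)); last first.
  by rewrite big_const_seq count_predT iter_addr_0 mulr_natl.
rewrite big_seq [in X in _ <= X]big_seq; apply: ler_sum => s sg.
apply: le_trans (IHn _) _; apply: fh.
by rewrite addnS -addSn leq_add2r (leq_trans (norm1D _ _)) // (norm1_gens sg) addn1.
Qed.

Lemma homo_succn_exp k : {homo (fun n => n.+1%:R ^+ k : R) : m n / (m <= n)%N >-> m <= n}.
Proof. by move=> m n mn; rewrite lerXn2r ?nnegrE // ler_nat. Qed.

(** [U] plus its bound is nonnegative, so its value at z is controlled by its mean after n steps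
    from 0, in which [U] contributes just U(0). Since n is of order |z|^2, exponents double. *)
Lemma poly_growth_of_lower_bound U C k : walk U = U -> 0 <= C ->
  (forall z, - (C * (norm1 z).+1%:R ^+ k) <= U z) ->
  exists B m, forall z, `|U z| <= B * (norm1 z).+1%:R ^+ m.
Proof.
move=> hU C0 lU; pose b z : R := (norm1 z).+1%:R ^+ k; pose m := (size gens + k)%N.
exists ((expR 1 * (`|U 0| + C)) * (size gens).+1%:R ^+ m + C), (2 * m)%N => z.
pose pos (a : int) := if 0 <= a then `|a|%N else 0%N.
have posB a : (pos a)%:Z - (pos (- a))%:Z = a.
  by rewrite /pos; case: (leP 0 a); case: (leP 0 (- a)); lia.
have posD a : (pos a + pos (- a) = `|a|)%N.
  by rewrite /pos; case: (leP 0 a); case: (leP 0 (- a)); lia.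
pose l : seq ('rV[int]_r * nat) := [seq (delta_mx 0 i, pos (z 0 i)) | i : 'I_r] ++
          [seq (- delta_mx 0 i, pos (- z 0 i)) | i : 'I_r].
have lg : map fst l = gens by rewrite map_cat; congr (_ ++ _); rewrite /image_mem -map_comp.
have sl : size l = size gens by rewrite -lg size_map.
have big_l (V : nmodType) (F : 'rV[int]_r * nat -> V) : \sum_(p <- l) F p =
    \sum_i F (delta_mx 0 i, pos (z 0 i)) + \sum_i F (- delta_mx 0 i, pos (- z 0 i)).
  by rewrite big_cat !big_image.
pose v z := 1 * U z + C * b z.
have v0 y : 0 <= v y by rewrite /v mul1r -lerBlDr sub0r; apply: lU.
have l1 : \sum_(p <- l) p.1 = 0 by rewrite big_l /= -big_split big1 // => i _; rewrite /= subrr.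
have lz : \sum_(p <- l) p.1 *+ p.2 = z.
  rewrite big_l -big_split /= [RHS]row_sum_delta; apply: eq_bigr => i _.
  by rewrite mulNrn -!scaler_nat -scalerBl; congr (_ *: _); rewrite !natz posB.
have lK : norm1 z = (\sum_(p <- l) p.2)%N.
  rewrite (big_l nat) /= -big_split; by apply: eq_bigr => i _; apply/esym/posD.
pose n := (size gens * (norm1 z).+1 ^ 2 + norm1 z)%N.
have := @le_avg_iter_nonneg R _ l v 0 v0; rewrite sl lg lz add0r => /(_ q0 l1 _ n lK erefl).
rewrite avg_iter_lin mul1r avg_iter_fix // => hv.
have hb : iter n walk b 0 <= n.+1%:R ^+ k.
  by have := @avg_iter_norm1 n _ 0 (@homo_succn_exp k); rewrite norm10 add0n.
have hE : U 0 + C * iter n walk b 0 <= (`|U 0| + C) * n.+1%:R ^+ k.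
  rewrite mulrDl lerD ?ler_wpM2l //; apply: le_trans (ler_norm _) _.
  by rewrite ler_peMr // exprn_ege1 // ler1n.
have hn : n.+1%:R <= (size gens).+1%:R * (norm1 z).+1%:R ^+ 2 :> R.
  by rewrite -natrX -natrM ler_nat /n; set q := size gens; set K := norm1 z; nia.
have hup : v z <= (expR 1 * (`|U 0| + C)) * (size gens).+1%:R ^+ m * (norm1 z).+1%:R ^+ (2 * m).
  apply: le_trans hv _.
  apply: (@le_trans _ _ (expR 1 * n.+1%:R ^+ size gens * ((`|U 0| + C) * n.+1%:R ^+ k))).
    by rewrite ler_wpM2l // mulr_ge0 ?expR_ge0 ?exprn_ge0.
  have -> : expR 1 * n.+1%:R ^+ size gens * ((`|U 0| + C) * n.+1%:R ^+ k) =
     expR 1 * (`|U 0| + C) * n.+1%:R ^+ m by rewrite exprD; ring.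
  rewrite -[X in _ <= X]mulrA exprM -exprMn ler_wpM2l ?mulr_ge0 ?expR_ge0 ?addr_ge0 //.
  by rewrite lerXn2r ?nnegrE ?mulr_ge0 ?exprn_ge0.
have b0 : 0 <= C * b z by rewrite mulr_ge0 ?exprn_ge0.
have hb2 : C * b z <= C * (norm1 z).+1%:R ^+ (2 * m).
  by rewrite ler_wpM2l // ler_weXn2l ?ler1n // /m; lia.
move: hup (v0 z) (lU z); rewrite mulrDl /v mul1r; set X := _ * _ ^+ (2 * m).
move=> h1 h2 h3; have X0 : 0 <= X by lra.
by rewrite ler_norml; apply/andP; split; rewrite -/(b z) in h3; lra.
Qed.

(** A nonzero difference of order j makes E U(X_n)^2 grow at least like n^j, while the crude |X_n|
    <= n only allows n^(2 k). The degree is sharpened later. *)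
Lemma deg_lt_of_poly_growth U B k : walk U = U ->
  (forall z, `|U z| <= B * (norm1 z).+1%:R ^+ k) -> deg_lt gens (2 * k).+1 U.
Proof.
move=> hU bU l lg lk x; apply/eqP; rewrite -sqrf_eq0; set t := _ ^+ 2.
set j := (2 * k).+1 in lk; set q : R := (size gens)%:R.
have qj : 0 < q ^+ j by rewrite exprn_gt0 // ltr0n.
have t0 : 0 <= t by rewrite sqr_ge0.
pose Y : R := (2 ^ j * j`!)%:R * q ^+ j * (B ^+ 2 * 2%:R ^+ (2 * k)).
have key n : (2 * j <= n)%N -> (norm1 x < n)%N -> n%:R * t <= Y.
  move=> jn xn; have n0 : 0 < n%:R :> R by rewrite ltr0n; lia.
  have h1 := @fdiffs_sqr_le R _ gens n l U x q0 hU lg; rewrite lk -/t -/q in h1.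
  have h2 : iter n walk (fun y => U y ^+ 2) x <= B ^+ 2 * (2%:R * n%:R) ^+ (2 * k).
    apply: (@le_trans _ _ (iter n walk (fun y => B ^+ 2 * (norm1 y).+1%:R ^+ (2 * k)) x)).
      apply: avg_iter_mono => y; rewrite mulnC exprM -exprMn -real_normK ?num_real //.
      by rewrite lerXn2r ?nnegrE // (le_trans _ (bU y)).
    rewrite avg_iterZ ler_wpM2l ?sqr_ge0 //.
    apply: le_trans (@avg_iter_norm1 n _ x (@homo_succn_exp (2 * k))) _.
    by rewrite lerXn2r ?nnegrE ?mulr_ge0 // -natrM ler_nat; lia.
  have h3 : n%:R ^+ j <= (2 ^ j * j`!)%:R * 'C(n, j)%:R :> R.
    by rewrite -natrX -natrM ler_nat expn_le_bin.
  have h4 := le_trans h1 h2.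
  rewrite mulrAC ler_pdivrMr // in h4.
  have h5 : n%:R ^+ j * t <= (2 ^ j * j`!)%:R * ('C(n, j)%:R * t).
    by rewrite mulrA ler_wpM2r.
  have h6 := le_trans h5 (ler_wpM2l (ler0n _ _) h4).
  rewrite -(ler_pM2l (x := n%:R ^+ (2 * k))) ?exprn_gt0 //.
  rewrite mulrA -exprSr; apply: (le_trans h6); rewrite exprMn /Y le_eqVlt.
  by apply/orP; left; apply/eqP; ring.
apply/negPn/negP => tn; have tp : 0 < t by rewrite lt_neqAle eq_sym tn.
have Y0 : 0 <= Y.
  apply: mulr_ge0; apply: mulr_ge0; [exact: ler0n|exact: ltW|exact: sqr_ge0|].
  exact: exprn_ge0.
have := archi_boundP (divr_ge0 Y0 t0); set a := Num.bound _ => ha.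
have := key (2 * j + (norm1 x).+1 + a)%N _ _; rewrite leNgt.
rewrite -ltr_pdivrMr // (lt_le_trans ha) ?ler_nat; last by lia.
by move=> /(_ _ _)/negP; apply => //; lia.
Qed.

(** Discrete integration: the differences have one degree less, and summing them along a geodesic
    from 0 costs one power of the norm. *)
Lemma growth_of_deg_lt D U : deg_lt gens D.+1 U ->
  exists2 B : R, 0 <= B & forall z, `|U z| <= B * (norm1 z).+1%:R ^+ D.
Proof.
elim: D U => [|D IHD] U hU.
  exists `|U 0| => // z; rewrite expr0 mulr1; elim/lattice_ind: z => // z s sg _.
  have := hU [:: s] _ erefl z; rewrite /= sg => /(_ isT)/eqP.
  by rewrite /fdiff subr_eq0 => /eqP ->.
have [B B0 hB] : exists2 B : R, 0 <= B &
    forall s z, s \in gens -> `|fdiff s U z| <= B * (norm1 z).+1%:R ^+ D.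
  have hs s : s \in gens -> exists2 B : R, 0 <= B &
      forall z, `|fdiff s U z| <= B * (norm1 z).+1%:R ^+ D.
    by move=> sg; apply: IHD => l lg lD; apply: (hU (s :: l)); rewrite /= ?sg ?lD.
  elim: gens hs => [|s S IHS] hs; first by exists 0.
  have [B1 B10 h1] := hs s (mem_head _ _).
  have [t tS|B2 B20 h2] := IHS; first by apply: hs; rewrite inE tS orbT.
  exists (B1 + B2); first by rewrite addr_ge0.
  move=> t z; rewrite inE mulrDl => /orP[/eqP ->|tS].
    by rewrite (le_trans (h1 z)) // lerDl mulr_ge0 ?exprn_ge0.
  by rewrite (le_trans (h2 t z tS)) // lerDr mulr_ge0 ?exprn_ge0.
have hU' z : `|U z| <= `|U 0| + B * ((norm1 z)%:R * (norm1 z).+1%:R ^+ D).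
  elim/lattice_ind: z => [|z s sg zs IHz]; first by rewrite lerDl !mulr_ge0 ?exprn_ge0.
  have -> : U (z + s) = U z + fdiff s U z by rewrite /fdiff; ring.
  apply: le_trans (ler_normD _ _) _; apply: le_trans (lerD IHz (hB s z sg)) _.
  rewrite -addrA lerD2l -mulrDr ler_wpM2l // -[X in _ + X]mul1r -mulrDl zs -natr1.
  rewrite ler_wpM2l ?addr_ge0 // lerXn2r ?nnegrE // ?addr_ge0 //.
  by rewrite !natr1 ler_nat.
exists (`|U 0| + B); first by rewrite addr_ge0.
move=> z; apply: le_trans (hU' z) _; rewrite mulrDl lerD //.
  by rewrite ler_peMr // exprn_ege1 // ler1n.
by rewrite ler_wpM2l // exprS ler_wpM2r ?exprn_ge0 // ler_nat.
Qed.

End Lattice.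

(** * The sharp degree bound *)

Section Sharp.
Variables (r : nat) (R : realType).
Hypothesis r0 : (0 < r)%N.
Implicit Types (z : 'rV[int]_r) (U : 'rV[int]_r -> R).

Notation gens := (gens r).
Notation walk := (@avg R _ gens).

(** The bounds 1 / (1 - t) of e^t and 1 / (1 + t) of e^-t have mean 1 / (1 - t^2) <= 1 + 2 t^2. *)
Lemma cosh_le (t : R) : 0 <= t -> t <= 2^-1 ->
  2^-1 * (expR t + expR (- t)) <= expR (2 * t ^+ 2).
Proof.
move=> t0 t1; have t2 : t ^+ 2 <= 4^-1 by nra.
have h1 : expR t <= (1 - t)^-1.
  rewrite -[t in expR t]opprK expRN lef_pV2 ?posrE ?expR_gt0 //; last by lra.
  by apply: le_trans (expR_ge1Dx _); lra.
have h2 : expR (- t) <= (1 + t)^-1.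
  by rewrite expRN lef_pV2 ?posrE ?expR_gt0 ?expR_ge1Dx //; lra.
apply: le_trans (expR_ge1Dx _).
apply: (@le_trans _ _ (1 - t ^+ 2)^-1).
  have -> : (1 - t ^+ 2)^-1 = 2^-1 * ((1 - t)^-1 + (1 + t)^-1).
    by field; rewrite !gt_eqF //; lra.
  by rewrite ler_wpM2l // lerD.
have s0 := sqr_ge0 t; rewrite -[_^-1]mul1r ler_pdivrMr; [nra|lra].
Qed.

(** Product of the 2 cosh (t z_i): an eigenfunction of [walk] for cosh t that dominates exp (t |z|)
    when t >= 0. *)
Let expsum (t : R) z : R :=
  \prod_i (expR (t * (z 0 i)%:~R) + expR (- (t * (z 0 i)%:~R))).

Let expsum_ge0 t z : 0 <= expsum t z.
Proof. by apply: prodr_ge0 => i _; rewrite addr_ge0 ?expR_ge0. Qed.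

Lemma avg_expsum t z :
  walk (expsum t) z = 2^-1 * (expR t + expR (- t)) * expsum t z.
Proof.
have h i : expsum t (z + delta_mx 0 i) + expsum t (z - delta_mx 0 i) =
    (expR t + expR (- t)) * expsum t z.
  rewrite /expsum (bigD1 i) //= [X in _ + X](bigD1 i) //= [in RHS](bigD1 i) //=.
  set P := \prod_(j < r | j != i) (expR (t * (z 0 j)%:~R) + _).
  have -> : \prod_(j < r | j != i) (expR (t * ((z + delta_mx 0 i) 0 j)%:~R) +
      expR (- (t * ((z + delta_mx 0 i) 0 j)%:~R))) = P.
    by apply: eq_bigr => j ji; rewrite !mxE (negbTE ji) andbF addr0.
  have -> : \prod_(j < r | j != i) (expR (t * ((z - delta_mx 0 i) 0 j)%:~R) +
      expR (- (t * ((z - delta_mx 0 i) 0 j)%:~R))) = P.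
    by apply: eq_bigr => j ji; rewrite !mxE (negbTE ji) andbF subr0.
  rewrite !mxE !eqxx /= intrD intrB mulrDr mulrBr !mulr1 !opprD !expRD opprK; ring.
rewrite /avg big_gens -big_split /= (eq_bigr _ (fun i _ => h i)) sumr_const card_ord.
rewrite size_gens natrD -mulr_natl.
have rn : r%:R != 0 :> R by rewrite pnatr_eq0 -lt0n.
by field; rewrite -natrD pnatr_eq0 -lt0n addn_gt0 r0.
Qed.

Lemma expR_norm1_le t z : 0 <= t -> expR (t * (norm1 z)%:R) <= expsum t z.
Proof.
move=> t0; rewrite /norm1 natr_sum mulr_sumr (big_morph expR (@expRD R) (@expR0 R)).
apply: ler_prod => i _; rewrite expR_ge0 /=.
have [z0|z0] := leP 0 (z 0 i).
  rewrite -[X in X%:~R](gez0_abs z0) -pmulrn lerDl expR_ge0 //.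
rewrite -mulrN -mulrNz -[X in _ + expR (_ * X%:~R)](ltz0_abs z0) -pmulrn lerDr expR_ge0 //.
Qed.

(** Diffusive scaling, at square times so that sqrt n = M is an integer. With t = a / M, (1 + |y|)^a
    <= M^a exp (t |y|), and cosh(t)^(M^2) <= exp (2 a^2) does not depend on M. *)
Lemma moment_bound (a : R) z : 0 <= a -> exists2 B : R, 0 <= B &
  exists M0 : nat, forall M, (M0 <= M)%N ->
    iter (M ^ 2) walk (fun y => (norm1 y).+1%:R `^ a) z <= B * M%:R `^ a.
Proof.
move=> a0; pose G : R := \prod_(i < r) (2 * expR `|(z 0 i)%:~R|).
have G0 : 0 <= G by apply: prodr_ge0 => i _; rewrite mulr_ge0 ?expR_ge0.
exists (expR (2 * a ^+ 2) * G); first by rewrite mulr_ge0 ?expR_ge0.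
have := archi_boundP (mulr_ge0 (ler0n _ 2) a0); set M0 := Num.bound _ => hM0.
exists M0.+1 => M M0M.
have M1 : 1 <= M%:R :> R by rewrite ler1n; lia.
have aM : 2 * a <= M%:R by rewrite (le_trans (ltW hM0)) // ler_nat; lia.
pose t := a / M%:R.
have Mp : 0 < M%:R :> R by lra.
have t0 : 0 <= t by rewrite divr_ge0 // ltW.
have t1 : t <= 2^-1 by rewrite ler_pdivrMr //; lra.
have h1 y : (norm1 y).+1%:R `^ a <= M%:R `^ a * expsum t y.
  apply: (@le_trans _ _ (M%:R `^ a * expR (t * (norm1 y)%:R))); last first.
    by rewrite ler_wpM2l ?powR_ge0 ?expR_norm1_le.
  have -> : t * (norm1 y)%:R = (norm1 y)%:R / M%:R * a by rewrite /t; ring.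
  rewrite expRM -powRM ?expR_ge0 //.
  apply: ge0_ler_powR; rewrite ?nnegrE ?mulr_ge0 ?expR_ge0 //.
  apply: (@le_trans _ _ (M%:R * (1 + (norm1 y)%:R / M%:R))).
    by rewrite mulrDr mulr1 mulrCA divff ?mulr1 ?gt_eqF // -natr1; lra.
  by rewrite ler_wpM2l ?expR_ge1Dx.
apply: (@le_trans _ _ (iter (M ^ 2) walk (fun y => M%:R `^ a * expsum t y) z)).
  exact: avg_iter_mono.
rewrite avg_iterZ mulrC.
rewrite ler_wpM2r ?powR_ge0 //.
set c := 2^-1 * (expR t + expR (- t)).
have iterE n y : iter n walk (expsum t) y = c ^+ n * expsum t y.
  elim: n y => [|n IHn] y; first by rewrite mul1r.
  rewrite iterS (_ : iter n walk (expsum t) = fun y => c ^+ n * expsum t y).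
    by have := avg_iterZ gens 1 (c ^+ n) (expsum t) y; rewrite /= => ->;
      rewrite avg_expsum exprS -/c; ring.
  by apply/funext => y'; rewrite IHn.
rewrite iterE {iterE}/c.
rewrite ler_pM ?expsum_ge0 ?exprn_ge0 ?mulr_ge0 ?addr_ge0 ?expR_ge0 //.
  apply: (@le_trans _ _ (expR (2 * t ^+ 2) ^+ (M ^ 2))).
    by rewrite lerXn2r ?cosh_le // nnegrE ?mulr_ge0 ?addr_ge0 ?expR_ge0.
  rewrite -expRM_natl ler_expR natrX /t le_eqVlt; apply/orP; left; apply/eqP.
  by field; rewrite gt_eqF.
apply: ler_prod => i _; rewrite addr_ge0 ?expR_ge0 //= mulr_natl mulr2n.
have tz : `|t * (z 0 i)%:~R| <= `|(z 0 i)%:~R|.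
  by rewrite normrM ger0_norm // ler_piMl //; lra.
by rewrite lerD // ler_expR (le_trans _ tz) ?ler_norm // -normrN ler_norm.
Qed.

(** Averaged, it plays the role of Hoelder's inequality between the moments of order 1, 2 and 4. The
    two terms handle t <= L and t >= L. *)
Lemma sqr_interpolation (t L : R) : 0 <= t -> 0 < L -> t ^+ 2 <= L * t + t ^+ 4 / L ^+ 2.
Proof.
move=> t0 L0; have [tL|/ltW Lt] := leP t L.
  apply: ler_wpDr; first by rewrite divr_ge0 ?exprn_ge0 // ltW.
  by rewrite expr2 ler_wpM2r.
apply: ler_wpDl; first by rewrite mulr_ge0 // ltW.
rewrite ler_pdivlMr ?exprn_gt0 // (_ : t ^+ 4 = t ^+ 2 * t ^+ 2); last by ring.
by rewrite ler_wpM2l ?exprn_ge0 // lerXn2r ?nnegrE // ltW.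
Qed.

(* If [U] had degree [D > d], then [E_n U^2] would grow like [n^D] by
   [fdiffs_sqr_le], while [E_n |U| = O(n^(d/2))] because [U] is harmonic and
   bounded below, and [E_n U^4 = O(n^(2 D))]. *)
Lemma deg_lt_pred_of_lower_bound U C d D : walk U = U -> 0 <= d -> 0 <= C ->
  (forall z, - (C * (norm1 z).+1%:R `^ d) <= U z) ->
  d < D%:R -> deg_lt gens D.+1 U -> deg_lt gens D U.
Proof.
move=> hU d0 C0 lU dD degU l lg lD x; apply/eqP; rewrite -sqrf_eq0; set t := _ ^+ 2.
have q0 : (0 < size gens)%N by rewrite size_gens addn_gt0 r0.
set q : R := (size gens)%:R.
have qD : 0 < q ^+ D by rewrite exprn_gt0 // ltr0n.
have tge0 : 0 <= t by rewrite sqr_ge0.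
have [B1 B10 hB1] := growth_of_deg_lt degU.
have [Bd Bd0 [Md hMd]] := moment_bound x d0.
have [B4 B40 [M4 hM4]] := moment_bound x (ler0n R (4 * D)).
(* After M^2 steps from [x], M large: E |U| <= A1 M^d, E U^4 <= A2 M^(4 D) and E U^2 >= c M^(2
   D). *)
pose A1 := `|U x| + 2 * C * Bd.
pose A2 := B1 ^+ 4 * B4.
pose c : R := t / ((2 ^ D * D`!)%:R * q ^+ D).
have den0 : 0 < (2 ^ D * D`!)%:R * q ^+ D :> R.
  by rewrite mulr_gt0 // ltr0n muln_gt0 expn_gt0 fact_gt0.
have A10 : 0 <= A1 by rewrite addr_ge0 ?mulr_ge0.
have A20 : 0 <= A2 by rewrite mulr_ge0 ?exprn_ge0.
have key M (K : R) : 0 < K -> (Md + M4 + 2 * D + 1 <= M)%N ->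
    c * M%:R ^+ (2 * D) <= K * A1 * (M%:R ^+ D * M%:R `^ d) + A2 / K ^+ 2 * M%:R ^+ (2 * D).
  move=> K0 hM.
  have [M0 MdM M4M DM] : [/\ (0 < M)%N, (Md <= M)%N, (M4 <= M)%N & (2 * D <= M ^ 2)%N].
    by clear -hM; split; nia.
  (* A polynomial of degree D has size M^D at distance M; this [L] gives the quartic term the order
     M^(2 D) of the left side. *)
  set n := (M ^ 2)%N; pose L := K * M%:R ^+ D.
  have Mp : 0 < M%:R :> R by rewrite ltr0n.
  have M1 : 1 <= M%:R `^ d.
    have := @ge0_ler_powR R d d0 1 M%:R; rewrite powR1 !nnegrE => -> //.
    by rewrite ler1n.
  have L0 : 0 < L by rewrite mulr_gt0 ?exprn_gt0.
  have h1 : c * M%:R ^+ (2 * D) <= iter n walk (fun y => U y ^+ 2) x.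
    apply: le_trans (@fdiffs_sqr_le R _ gens n l U x q0 hU lg); rewrite lD -/t -/q.
    have : n%:R ^+ D <= (2 ^ D * D`!)%:R * 'C(n, D)%:R :> R.
      by rewrite -natrX -natrM ler_nat expn_le_bin.
    rewrite {1}/n natrX -exprM => hn.
    rewrite (_ : c * _ = t * M%:R ^+ (2 * D) / ((2 ^ D * D`!)%:R * q ^+ D)); last first.
      by rewrite /c mulrAC.
    rewrite ler_pdivrMr //.
    have -> : 'C(n, D)%:R / q ^+ D * t * ((2 ^ D * D`!)%:R * q ^+ D) =
       t * ((2 ^ D * D`!)%:R * 'C(n, D)%:R) by field; rewrite gt_eqF.
    by rewrite ler_wpM2l.
  apply: (le_trans h1).
  apply: (@le_trans _ _ (iter n walk (fun y => L * `|U y| + (L ^+ 2)^-1 * U y ^+ 4) x)).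
    apply: avg_iter_mono => y; have := sqr_interpolation (normr_ge0 (U y)) L0.
    by rewrite -!normrX ![`|_ ^+ _|]ger0_norm ?exprn_even_ge0 // [U y ^+ 4 / _]mulrC.
  rewrite avg_iter_lin; apply: lerD.
    rewrite [X in _ <= X](_ : _ = L * (A1 * M%:R `^ d)); last by rewrite /L; ring.
    rewrite ler_wpM2l ?(ltW L0) //.
    (* The lower bound on [U] gives |U| <= U + 2 C (1 + |y|)^d, and the mean of [U] is U(x). *)
    apply: (@le_trans _ _ (iter n walk (fun y => 1 * U y + (2 * C) * (norm1 y).+1%:R `^ d) x)).
      apply: avg_iter_mono => y; have := lU y.
      set b := (norm1 y).+1%:R `^ d; have b0 : 0 <= C * b by rewrite mulr_ge0 ?powR_ge0.
      by move=> h; rewrite ler_norml; apply/andP; split; lra.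
    rewrite avg_iter_lin mul1r avg_iter_fix // /A1 [X in _ <= X]mulrDl lerD //.
      by rewrite (le_trans (ler_norm _)) // ler_peMr.
    by rewrite -[X in _ <= X]mulrA ler_wpM2l ?mulr_ge0 // hMd.
  rewrite [X in _ <= X](_ : _ = (L ^+ 2)^-1 * (A2 * M%:R ^+ (4 * D))); last first.
    rewrite /L (_ : (4 * D = 2 * D + (D + D))%N); last by rewrite addnn -mul2n -mulnDl.
    rewrite !exprD; field; rewrite ?gt_eqF ?exprn_gt0 //.
  rewrite ler_wpM2l ?invr_ge0 ?exprn_ge0 ?(ltW L0) //.
  apply: (@le_trans _ _ (iter n walk (fun y => B1 ^+ 4 * (norm1 y).+1%:R `^ (4 * D)%:R) x)).
    apply: avg_iter_mono => y; rewrite powR_mulrn // mulnC exprM -exprMn.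
    rewrite -[U y ^+ 4]ger0_norm ?exprn_even_ge0 // normrX.
    by rewrite lerXn2r ?nnegrE ?hB1 // mulr_ge0 ?exprn_ge0.
  by rewrite avg_iterZ /A2 -mulrA ler_wpM2l ?exprn_ge0 // -powR_mulrn ?hM4.
apply/negPn/negP => tn; have tp : 0 < t by rewrite lt_neqAle eq_sym tn.
have c0 : 0 < c by rewrite divr_gt0.
(* [K] leaves the quartic term at most half of [c]. *)
have [K K1 hK] : exists2 K : R, 1 <= K & A2 / K ^+ 2 <= c / 2.
  pose K := 1 + 2 * A2 / c; have AK : 0 <= 2 * A2 / c.
    by apply: divr_ge0; [exact: mulr_ge0|exact: ltW].
  have K1 : 1 <= K by rewrite lerDl.
  exists K => //; rewrite ler_pdivrMr ?exprn_gt0 //; last by lra.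
  have h : 2 * A2 <= c * K by have -> : c * K = c + 2 * A2; [rewrite /K; field; rewrite gt_eqF|lra].
  by rewrite expr2; nra.
have Dd : 0 < D%:R - d by rewrite subr_gt0.
have K0 : 0 < K by lra.
(* Chosen so that c Y = c + 2 K A1: as soon as M^(D - d) >= Y, the term with A1 is too small. *)
pose Y := 1 + 2 * K * A1 / c; have Y0 : 0 <= Y.
  apply: addr_ge0 => //; apply: divr_ge0; last exact: ltW.
  by apply: mulr_ge0 => //; apply: mulr_ge0 => //; apply: ltW.
have := archi_boundP (powR_ge0 Y (D%:R - d)^-1); set M0 := Num.bound _ => hM0.
set M := (Md + M4 + 2 * D + 1 + M0)%N.
have [MM M0M] : (Md + M4 + 2 * D + 1 <= M)%N /\ (M0 <= M)%N.
  by rewrite /M leq_addr leq_addl.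
clearbody M.
have Mp : 0 < M%:R :> R by rewrite ltr0n (leq_trans _ MM) // addn1.
have hY : Y <= M%:R `^ (D%:R - d).
  have -> : Y = (Y `^ (D%:R - d)^-1) `^ (D%:R - d).
    by rewrite -powRrM mulVf ?gt_eqF // powRr1.
  apply: ge0_ler_powR; rewrite ?nnegrE ?powR_ge0 ?(ltW Dd) //.
  by rewrite ltW // (lt_le_trans hM0) // ler_nat.
have hkey := key M K K0 MM.
have MD : M%:R ^+ (2 * D) = M%:R `^ (D%:R - d) * (M%:R ^+ D * M%:R `^ d) :> R.
  rewrite mulrCA -powRD ?(gt_eqF Mp) ?implybT // subrK powR_mulrn //.
  by rewrite -exprD addnn -mul2n.
have W0 : 0 < M%:R ^+ D * M%:R `^ d :> R by rewrite mulr_gt0 ?exprn_gt0 ?powR_gt0.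
have cY : c + 2 * K * A1 = c * Y.
  by rewrite /Y; field; rewrite gt_eqF.
move: hkey hY MD W0; set W := _ * M%:R `^ d; set V := M%:R ^+ (2 * D).
set P := M%:R `^ _ => hkey hY MD W0.
have V0 : 0 < V by rewrite exprn_gt0.
have h1 : c / 2 * V <= K * A1 * W.
  have := ler_wpM2r (ltW V0) hK; lra.
have h2 : c * Y * W <= c * V by rewrite MD -mulrA ler_pM2l // ler_pM2r.
have cW : 0 < c * W by rewrite mulr_gt0.
move: h2; rewrite -cY; nra.
Qed.
End Sharp.

(** * Sharp growth and periodicity on the lattice *)

Section LatticeHarmonic.
Variables (r : nat) (R : realType).
Hypothesis r0 : (0 < r)%N.
Implicit Types (z w : 'rV[int]_r) (U : 'rV[int]_r -> R).

Lemma lattice_growth_of_lower_bound U C d : avg (gens r) U = U -> 0 <= d -> 0 <= C ->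
  (forall z, - (C * (norm1 z).+1%:R `^ d) <= U z) ->
  (exists k, deg_lt (gens r) k U) /\
  exists2 B : R, 0 <= B & forall z, `|U z| <= B * (norm1 z).+1%:R `^ d.
Proof.
move=> hU d0 C0 lU.
have powle (e f : R) z : e <= f -> (norm1 z).+1%:R `^ e <= (norm1 z).+1%:R `^ f :> R.
  by move=> ef; apply: ler_powR => //; rewrite ler1n.
have [k dk] : exists k : nat, d <= k%:R.
  by exists (Num.bound d); apply/ltW/archi_boundP.
have lU' z : - (C * (norm1 z).+1%:R ^+ k) <= U z.
  by apply: le_trans (lU z); rewrite lerN2 -powR_mulrn // ler_wpM2l ?powle.
have [B0 [m hB0]] := poly_growth_of_lower_bound r0 hU C0 lU'.
have hm := deg_lt_of_poly_growth r0 hU hB0.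
split; first by exists (2 * m).+1.
(* The degree is lowered step by step as long as it exceeds [d]. *)
have [D Dd hD] : exists2 D : nat, D%:R <= d & deg_lt (gens r) D.+1 U.
  elim: (2 * m)%N hm => [|D IHD] hD; first by exists 0%N.
  have [Dd|dD] := leP D.+1%:R d; first by exists D.+1.
  by apply: IHD; apply: (deg_lt_pred_of_lower_bound r0 hU d0 C0 lU dD hD).
have [B B1 hB] := growth_of_deg_lt hD.
exists B => // z; apply: le_trans (hB z) _.
by rewrite ler_wpM2l // -powR_mulrn // powle.
Qed.

(** By induction the differences of [U] have period [w], so U(z + w) - U(z) is a constant c, and the
    period [w *+ q] gives q c = 0. *)
Lemma deg_lt_periodic k U w q : (0 < q)%N -> deg_lt (gens r) k U ->
  (forall z, U (z + w *+ q) = U z) -> forall z, U (z + w) = U z.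
Proof.
move=> q0; elim: k U => [|k IHk] U hU per.
  by have h y : U y = 0 := hU [::] isT erefl y; move=> z; rewrite !h.
pose c := U w - U 0.
have hc z : U (z + w) = U z + c.
  elim/lattice_ind: z => [|z s sg _ IHz]; first by rewrite add0r /c addrC subrK.
  have := IHk (fdiff s U) _ _ z; rewrite /fdiff addrAC IHz => h.
  suff : U (z + s + w) - (U z + c) = U (z + s) - U z by lra.
  apply: h => [l lg lk y|y]; first by apply: (hU (s :: l)); rewrite /= ?sg ?lk.
  by rewrite /= addrAC !per.
have hn n z : U (z + w *+ n) = U z + n%:R * c.
  elim: n => [|n IHn]; first by rewrite mulr0n addr0 mul0r addr0.
  by rewrite mulrSr addrA hc IHn -natr1; ring.
have /eqP : q%:R * c = 0 by have := hn q 0; rewrite per; lra.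
rewrite mulf_eq0 pnatr_eq0 -leqn0 leqNgt q0 /= => /eqP c0 z.
by rewrite hc c0 addr0.
Qed.

End LatticeHarmonic.

(** * Words in the generators and lifting to the lattice *)

Section Words.
Variables (G : zmodType) (r : nat) (S : (r + r).-tuple G).
Hypothesis hS : symmetric_generating S.
Implicit Types (z : 'rV[int]_r) (x y p : G) (w : seq G).

(** The homomorphism from Z^r to [G] given by the first half of [S]; negative coordinates account
    for the second half. *)
Definition word_val z : G := \sum_i tnth S (lshift r i) *~ z 0 i.

Lemma word_valD z z' : word_val (z + z') = word_val z + word_val z'.
Proof. by rewrite /word_val -big_split; apply: eq_bigr => i _; rewrite mxE mulrzDr. Qed.

Lemma word_valN z : word_val (- z) = - word_val z.
Proof. by rewrite /word_val -sumrN; apply: eq_bigr => i _; rewrite mxE mulrNz. Qed.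

Lemma word_val0 : word_val 0 = 0.
Proof. by rewrite /word_val big1 // => i _; rewrite mxE mulr0z. Qed.

Lemma word_val_delta i : word_val (delta_mx 0 i) = tnth S (lshift r i).
Proof.
rewrite /word_val (bigD1 i) //= big1 => [|j ji]; rewrite mxE ?eqxx ?addr0 //.
by rewrite (negbTE ji) andbF.
Qed.

Lemma word_val_surj x : exists z, x = word_val z.
Proof.
have [_ gen] := hS; pose H : {pred G} := fun x => `[< exists z, x = word_val z >].
suff : x \in H by move=> /asboolP.
apply: gen => [|y].
  split=> [|y y' /asboolP[z ->] /asboolP[z' ->]]; apply/asboolP.
    by exists 0; rewrite word_val0.
  by exists (z - z'); rewrite word_valD word_valN.
move=> /tnthP[i ->]; apply/asboolP; case: (split_ordP i) => j ->.
  by exists (delta_mx 0 j); rewrite word_val_delta.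
by exists (- delta_mx 0 j); rewrite word_valN word_val_delta hS.1.
Qed.

Lemma word_val_gens s : s \in gens r -> word_val s \in S.
Proof.
rewrite mem_cat => /orP[] /codomP[i ->]; rewrite ?word_valN word_val_delta.
  exact: mem_tnth.
by rewrite -hS.1 mem_tnth.
Qed.

Lemma gens_of_mem x : x \in S -> exists2 s, s \in gens r & word_val s = x.
Proof.
move=> /tnthP[i ->]; case: (split_ordP i) => j ->.
  by exists (delta_mx 0 j); rewrite ?word_val_delta //; case/andP: (mem_gens j).
exists (- delta_mx 0 j); first by case/andP: (mem_gens j).
by rewrite word_valN word_val_delta hS.1.
Qed.

(** With [word_of_path]: the distance from x to y is the least norm of a lift of y - x. *)
Lemma joins_word x z : exists2 w, joins S x (x + word_val z) w & size w = norm1 z.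
Proof.
elim/lattice_ind: z => [|z s sg zs [w [pw lw] sw]].
  by exists [::]; rewrite ?norm10 // /joins word_val0 addr0.
exists (rcons w (x + word_val (z + s))); last by rewrite size_rcons sw zs.
split; last by rewrite last_rcons.
rewrite rcons_path pw lw /cayley word_valD /=.
by rewrite opprD addrACA subrr add0r addrAC subrr add0r word_val_gens.
Qed.

Lemma word_of_path x w : path (cayley S) x w ->
  exists2 z, last x w = x + word_val z & (norm1 z <= size w)%N.
Proof.
elim: w x => [|y w IHw] x /=.
  by move=> _; exists 0; rewrite ?word_val0 ?addr0 ?norm10.
move=> /andP[/gens_of_mem[s sg sE] /IHw[z lz zw]]; exists (s + z).
  by rewrite lz word_valD sE addrA addrC [x + _]addrC subrK addrC.
by rewrite (leq_trans (norm1D _ _)) // norm1_gens.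
Qed.

Lemma word_distP x y : (exists2 w, joins S x y w & size w = word_dist S x y) /\
  (forall w, joins S x y w -> (word_dist S x y <= size w)%N).
Proof.
rewrite /word_dist; set P := [set k | _].
suff : P (xget 0%N P) by [].
(* As [S] generates, a path exists and [xget] does not return its default. *)
apply: xgetPex.
have [z yE] := word_val_surj (y - x).
have [w0 jw0 _] := joins_word x z; rewrite -yE addrC subrK in jw0.
pose Q k := `[< exists2 w, joins S x y w & size w = k >].
have exQ : exists k, Q k by exists (size w0); apply/asboolP; exists w0.
case: (ex_minnP exQ) => k /asboolP Qk kmin; exists k; split=> // w jw.
by apply: kmin; apply/asboolP; exists w.
Qed.

Lemma word_dist_le x z : (word_dist S x (x + word_val z) <= norm1 z)%N.
Proof. by have [w jw <-] := joins_word x z; apply: (word_distP _ _).2. Qed.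

Lemma word_dist_ge x y : exists2 z, y = x + word_val z & (norm1 z <= word_dist S x y)%N.
Proof.
by have [[w [pw <-] <-] _] := word_distP x y; apply: word_of_path.
Qed.

Variable R : realType.
Implicit Types u : G -> R.

(** From k + 1 <= (m + 1) (n + 1); it makes a change of base point cost a constant factor. *)
Lemma succn_powR_shift (d : R) m n k : 0 <= d -> (k <= m + n)%N ->
  k.+1%:R `^ d <= m.+1%:R `^ d * n.+1%:R `^ d.
Proof.
move=> d0 kmn; rewrite -powRM //; apply: ge0_ler_powR => //; rewrite ?nnegrE ?mulr_ge0 //.
by rewrite -natrM ler_nat; nia.
Qed.

Lemma growth_word_le p (d : R) : 0 <= d ->
  exists2 B : R, 0 <= B & forall z, growth S p d (word_val z) <= B * (norm1 z).+1%:R `^ d.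
Proof.
move=> d0; have [w pE] := word_val_surj p.
exists ((norm1 w).+1%:R `^ d); first exact: powR_ge0.
move=> z; rewrite /growth natr1; apply: succn_powR_shift => //.
have -> : word_val z = p + word_val (z - w).
  by rewrite pE word_valD word_valN addrC subrK.
by rewrite (leq_trans (word_dist_le _ _)) // (leq_trans (norm1D _ _)) // norm1N addnC.
Qed.

(** The lift follows a geodesic from [p]; an arbitrary lift of [x] may be far longer. *)
Lemma growth_word_ge p (d : R) : 0 <= d -> exists2 B : R, 0 <= B &
  forall x, exists2 z, x = word_val z & (norm1 z).+1%:R `^ d <= B * growth S p d x.
Proof.
move=> d0; have [w pE] := word_val_surj p.
exists ((norm1 w).+1%:R `^ d); first exact: powR_ge0.
move=> x; have [z xE zx] := word_dist_ge p x.
exists (w + z); first by rewrite word_valD xE pE.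
rewrite /growth natr1; apply: succn_powR_shift => //.
by rewrite (leq_trans (norm1D _ _)) // leq_add2l.
Qed.

(** Eliminates base point and word metric: growth is read on Z^r, common to [G] and its
    quotients. *)
Lemma HdP p (d : R) u : 0 <= d -> Hd S p d u <->
  harmonic_on S u /\ exists C : R, forall z, `|u (word_val z)| <= C * (norm1 z).+1%:R `^ d.
Proof.
move=> d0; split=> -[hu [C hC]]; split=> //.
  have [B B0 hB] := growth_word_le p d0; exists (`|C| * B) => z.
  apply: le_trans (hC _) _; apply: (@le_trans _ _ (`|C| * growth S p d (word_val z))).
    by rewrite ler_wpM2r ?powR_ge0 ?ler_norm.
  by rewrite -mulrA ler_wpM2l.
have [B B0 hB] := growth_word_ge p d0; exists (`|C| * B) => x.
have [z -> hz] := hB x; apply: le_trans (hC z) _.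
apply: (@le_trans _ _ (`|C| * (norm1 z).+1%:R `^ d)).
  by rewrite ler_wpM2r ?powR_ge0 ?ler_norm.
by rewrite -mulrA ler_wpM2l.
Qed.

Hypothesis r0 : (0 < r)%N.

Lemma avg_word u : harmonic_on S u -> avg (gens r) (u \o word_val) = u \o word_val.
Proof.
move=> hu; apply/funext => z; have := hu (word_val z).
rewrite /laplacian sumrB big_const_seq count_predT iter_addr_0 size_tuple.
rewrite big_tuple big_split_ord /= /avg big_gens size_gens.
have e1 i : u (word_val z + tnth S (lshift r i)) = (u \o word_val) (z + delta_mx 0 i).
  by rewrite /= word_valD word_val_delta.
have e2 i : u (word_val z + tnth S (rshift r i)) = (u \o word_val) (z - delta_mx 0 i).
  by rewrite /= word_valD word_valN word_val_delta hS.1.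
rewrite (eq_bigr _ (fun i _ => e1 i)) (eq_bigr _ (fun i _ => e2 i)).
move=> /eqP; rewrite subr_eq0 => /eqP ->.
by rewrite -[X in _ * X = _]mulr_natl mulrA mulVf ?mul1r // pnatr_eq0 -lt0n addn_gt0 r0.
Qed.

Lemma lower_bounded_harmonic_Hd p (d : R) u : 0 <= d ->
  lower_bounded_harmonic S p d u ->
  Hd S p d u /\ exists k, deg_lt (gens r) k (u \o word_val).
Proof.
move=> d0 [hu [C hC]]; have [B B0 hB] := growth_word_le p d0.
have lU z : - (`|C| * B * (norm1 z).+1%:R `^ d) <= (u \o word_val) z.
  apply: le_trans (hC _); rewrite mulNr lerN2.
  apply: (@le_trans _ _ (`|C| * growth S p d (word_val z))).
    by rewrite ler_wpM2r ?powR_ge0 ?ler_norm.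
  by rewrite -mulrA ler_wpM2l.
have [hk [B1 _ hB1]] :=
  lattice_growth_of_lower_bound r0 (avg_word hu) d0 (mulr_ge0 (normr_ge0 C) B0) lU.
by split=> //; apply/HdP => //; split=> //; exists B1.
Qed.

Lemma Hd_lower_bounded p (d : R) u : Hd S p d u -> lower_bounded_harmonic S p d u.
Proof.
move=> [hu [C hC]]; split=> //; exists C => x; rewrite mulNr.
by have := hC x; rewrite ler_norml => /andP[].
Qed.

(** The lift of [u] is a polynomial with period q times a lift of [t], so [deg_lt_periodic]
    applies. *)
Lemma Hd_torsion p (d : R) u t q : 0 <= d -> Hd S p d u -> (0 < q)%N -> t *+ q = 0 ->
  forall x, u (x + t) = u x.
Proof.
move=> d0 /Hd_lower_bounded/(lower_bounded_harmonic_Hd d0)[_ [k hk]] q0 tq x.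
have [z ->] := word_val_surj x; have [w tE] := word_val_surj t.
have val_muln n : word_val (w *+ n) = t *+ n.
  by elim: n => [|n IHn]; rewrite ?word_val0 // !mulrS word_valD IHn tE.
have := deg_lt_periodic q0 hk (w := w) _ z; rewrite /= word_valD tE; apply => y.
by rewrite /= word_valD val_muln tq addr0.
Qed.

(** [Hd] is a linear space containing the functions that span [HMd]; conversely its members are
    themselves bounded below. *)
Lemma HMd_Hd p (d : R) : 0 <= d -> HMd S p d = Hd S p d.
Proof.
move=> d0; apply/seteqP; split=> u; last first.
  move=> hu; exists 1%N, (fun=> 1), (fun=> u); split=> [_|x].
    exact: Hd_lower_bounded.
  by rewrite big_ord1 mul1r.
move=> [k [c [v [hv uE]]]].
have hvd i : Hd S p d (v i) by have [] := lower_bounded_harmonic_Hd d0 (hv i).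
split=> [x|].
  rewrite /laplacian; under eq_bigr do rewrite !uE -sumrB.
  rewrite exchange_big big1 // => i _ /=.
  under eq_bigr do rewrite -mulrBr.
  by rewrite -mulr_sumr -/(laplacian S (v i) x) (hvd i).1 mulr0.
have /choice[C hC] i := (hvd i).2.
exists (\sum_i `|c i| * C i) => x; rewrite uE mulr_suml.
apply: le_trans (ler_norm_sum _ _ _) _; apply: ler_sum => i _.
by rewrite normrM -mulrA ler_wpM2l.
Qed.

End Words.

(** * Projection to the torsion-free part *)

(** Pigeonhole: two of the multiples of [t] by 0, ..., [#|T|] coincide. *)
Lemma finite_group_torsion (T : finType) (G : zmodType) (f : G -> T) (t : G) :
  injective f -> exists2 q, (0 < q)%N & t *+ q = 0.
Proof.
move=> f_inj; apply: contrapT => ht.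
pose h (i : 'I_#|T|.+1) := f (t *+ i).
suff h_inj : injective h by have := leq_card h h_inj; rewrite card_ord ltnn.
move=> i j /f_inj tij; apply/eqP; apply: contra_notT ht => ij.
wlog ltij : i j tij ij / (i < j)%N.
  by move=> H; case: (ltngtP i j) => [|ji|/val_inj/eqP]; [exact: H|
    by apply: (H j i) => //; rewrite eq_sym|rewrite (negbTE ij)].
by exists (j - i)%N; rewrite ?subn_gt0 // mulrnBr ?tij ?subrr // ltnW.
Qed.

Section Projection.
Variables (G1 G2 : zmodType) (r : nat) (S : (r + r).-tuple (G1 * G2)%type).
Hypothesis hS : symmetric_generating S.

(** Preimages under the projection turn a subgroup of [G1] containing the projected list into one of
    the whole group containing [S]. *)
Lemma symmetric_generating_fst : symmetric_generating (map_tuple fst S).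
Proof.
have [sym gen] := hS; split=> [i|H [H0 HB] SH x]; first by rewrite !tnth_map sym.
suff : (x, 0 : G2) \in [pred y : G1 * G2 | y.1 \in H] by [].
apply: gen => [|y yS]; last by apply: SH; apply: map_f.
by split=> [|y y' hy hy']; rewrite inE //=; apply: HB.
Qed.

Lemma word_val_fst (z : 'rV[int]_r) : (word_val S z).1 = word_val (map_tuple fst S) z.
Proof.
rewrite /word_val (big_morph fst (id1 := 0) (op1 := +%R)) //.
by apply: eq_bigr => i _; rewrite tnth_map raddfMz.
Qed.

Lemma laplacian_fst (R : realType) (g : G1 -> R) x :
  laplacian S (fun x => g x.1) x = laplacian (map_tuple fst S) g x.1.
Proof. by rewrite /laplacian big_map. Qed.

End Projection.

Theorem theorem1p3 (R : realType) (m l : nat) (p a : 'I_l -> nat)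
    (G1 G2 : zmodType) (r : nat) (S : (r + r).-tuple (G1 * G2)%type)
    (o : (G1 * G2)%type) (o1 : G1) (d : R)
    (hm : (1 <= m)%N)
    (hp : forall i, prime (p i)) (ha : forall i, (1 <= a i)%N)
    (hG1 : isom_Zm m G1)
    (hG2 : isom_sum_Zq (fun i => (p i ^ a i)%N) G2)
    (hS : symmetric_generating S)
    (hd : 0 <= d) :
  HMd S o d = Hd S o d /\
  Hd S o d =
    (fun (g : G1 -> R) (x : G1 * G2) => g x.1) @` Hd (map_tuple fst S) o1 d.
Proof.
(* With r = 0 the list is empty and the group trivial, which m >= 1 excludes. *)
have r0 : (0 < r)%N.
  case: r S hS => // S0 [_ gen].
  have triv (x : G1 * G2) : x = 0.
    apply/eqP; apply: (gen (pred1 0)) => [|y /tnthP[[]]//].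
    by split=> [|u v]; rewrite !inE // => /eqP -> /eqP ->; rewrite subrr.
  have [f [g _ gK]] := hG1.
  have /rowP/(_ (Ordinal hm)) : const_mx 1 = 0 :> 'rV[int]_m.
    by rewrite -(gK (const_mx 1)) (congr1 fst (triv (g (const_mx 1), 0)) : g _ = 0) raddf0.
  by rewrite !mxE => /eqP; rewrite oner_eq0.
split; first exact: HMd_Hd.
have hS1 := symmetric_generating_fst hS.
(* Through [HdP] both spaces are described on the same lattice, so base points and word metrics
   disappear. *)
apply/seteqP; split=> [u hu|_ [g /(HdP hS1 _ _ hd)[hg [C hC]] <-]]; last first.
  apply/(HdP hS _ _ hd); split=> [x|]; first by rewrite laplacian_fst hg.
  by exists C => z; rewrite word_val_fst.
have [f [_ /bij_inj f_inj]] := hG2.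
(* Elements of the finite factor are torsion, hence [u] is invariant under them. *)
have inv x t : u (x + (0, t)) = u x.
  have [q q0 tq] := finite_group_torsion t f_inj.
  apply: (Hd_torsion hS r0 hd hu q0).
  have -> : (0, t) *+ q = (0 *+ q, t *+ q) :> G1 * G2.
    by elim: q {q0 tq} => // q IHq; rewrite !mulrS IHq.
  by rewrite mul0rn tq.
pose g y := u (y, 0).
have uE : (fun x => g x.1) = u.
  by apply/funext => -[y t]; rewrite /g -(inv (y, 0) t) /=; congr u; congr pair;
    rewrite ?addr0 ?add0r.
exists g => //; move: hu; rewrite -uE => /(HdP hS _ _ hd)[hu [C hC]].
apply/(HdP hS1 _ _ hd); split=> [y|].
  by have := hu (y, 0); rewrite laplacian_fst.
by exists C => z; rewrite -word_val_fst; apply: hC.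
Qed.
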